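(* For all integers $a,b\ge 1$, the complete bipartite graph $K_{a,b}$ is $\mathsf{LF}$-coverable.
   Context: All graphs are finite, simple and undirected. A linear forest is a graph every connected component of which is a path (a single vertex is a path). A linear forest in $G$ is a subgraph of $G$ that is a linear forest; it is called maximal if no other linear forest in $G$ has a greater number of edges. $\mathsf{LF}$-cover: let $F$ be a maximal linear forest in $G$ and $S\subseteq V(F)$. The pair $(F,S)$ is an $\mathsf{LF}$-cover of $G$ if: (1) no vertex in $S$ is a leaf of $F$, where a leaf of $F$ means a vertex of degree at most $1$ in $F$ (so isolated vertices of $F$ count as leaves); (2) no two vertices in $S$ are adjacent in $F$; (3) for every edge $\{i,j\}\in E(G)$, either at least one of $i,j$ belongs to $S$, or both $i$ and $j$ belong to the same connected component of $F\setminus S$. $G$ is $\mathsf{LF}$-coverable if it has an $\mathsf{LF}$-cover. *)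

(* Defs.v *)
From mathcomp Require Import all_boot.

Set Implicit Arguments.
Unset Strict Implicit.
Unset Printing Implicit Defensive.

Record sgraph := SGraph {
  vertex :> finType;
  adj : rel vertex;
  adj_sym : symmetric adj;
  adj_irr : irreflexive adj
}.

(* The edges of G, as unordered pairs. *)
Definition edges (G : sgraph) : {set {set G}} :=
  [set e | [exists x, exists y, adj x y && (e == [set x; y])]].

(* A subgraph need be neither induced nor spanning. *)
Record subgraph (G : sgraph) := Subgraph {
  sverts : {set G};
  sedges : {set {set G}};
  sedges_edges : sedges \subset edges G;
  sedges_sverts : forall e, e \in sedges -> e \subset sverts
}.

Section Subgraph.
Variable G : sgraph.
Implicit Types (F : subgraph G) (S C : {set G}).

Definition sadj F : rel G := fun x y => [set x; y] \in sedges F.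

Definition sdeg F (x : G) : nat := #|[set y | sadj F x y]|.

Definition leaf F (x : G) : bool := (x \in sverts F) && (sdeg F x <= 1).

Lemma del_sedges_edges F S :
  [set e in sedges F | [disjoint e & S]] \subset edges G.
Proof.
by apply/subsetP=> e; rewrite inE => /andP[/(subsetP (sedges_edges F))].
Qed.

Lemma del_sedges_sverts F S e :
  e \in [set e in sedges F | [disjoint e & S]] -> e \subset sverts F :\: S.
Proof.
by rewrite inE subsetD => /andP[/sedges_sverts -> ->].
Qed.

(* F \ S: the vertices in S are removed together with all incident edges. *)
Definition del_verts F S : subgraph G :=
  Subgraph (del_sedges_edges F S) (@del_sedges_sverts F S).

(* The vertex sets of the connected components of F. *)
Definition components F : {set {set G}} :=
  equivalence_partition (connect (sadj F)) (sverts F).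

(* The subgraph of F induced by C is a path s_0 - s_1 - ... - s_k, k >= 0. *)
Definition induces_path F C : Prop :=
  exists s : seq G,
    [/\ s != [::], uniq s, C =i s &
        {in C &, forall x y,
          sadj F x y = (index y s == (index x s).+1) ||
                       (index x s == (index y s).+1)}].

Definition linear_forest F : Prop :=
  forall C, C \in components F -> induces_path F C.

Definition maximal_linear_forest F : Prop :=
  linear_forest F /\
  forall F', linear_forest F' -> #|sedges F'| <= #|sedges F|.

Definition LF_cover F S : Prop :=
  [/\ maximal_linear_forest F,
      S \subset sverts F,
      {in S, forall x, ~~ leaf F x},
      {in S &, forall x y, ~~ sadj F x y} &
      forall i j : G, adj i j ->
        (i \in S \/ j \in S) \/
        exists2 C, C \in components (del_verts F S) & i \in C /\ j \in C].

End Subgraph.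

Definition LF_coverable (G : sgraph) : Prop :=
  exists (F : subgraph G) (S : {set G}), LF_cover F S.

Section CompleteBipartite.
Variables a b : nat.

Definition Kab_adj (x y : 'I_a + 'I_b) : bool :=
  match x, y with
  | inl _, inr _ | inr _, inl _ => true
  | _, _ => false
  end.

Lemma Kab_adj_sym : symmetric Kab_adj.
Proof. by move=> [x|x] [y|y]. Qed.

Lemma Kab_adj_irr : irreflexive Kab_adj.
Proof. by move=> [x|x]. Qed.

Definition complete_bipartite : sgraph := SGraph Kab_adj_sym Kab_adj_irr.

End CompleteBipartite.

(* Main.v *)
Require Import Defs.
From mathcomp Require Import all_boot.

(** Let [A] and [~: A] be the two sides of a complete bipartite graph.

    Upper bound. Every edge meets [A], and a linear forest has degrees at most
    2, so it has at most [2 * #|A|] edges ([linear_forest_leq_cover]). A linear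
    forest also has a vertex of degree at most 1, such as an end of one of its
    paths ([linear_forest_low_degree]); if this vertex lies in [A], the bound
    drops by one ([linear_forest_ltn_cover]). When the two sides have equal
    size, either of them can play the role of [A], so the bound [2 * #|A| - 1]
    holds wherever that vertex lies.

    Attaining it. A path alternating between the sides ([zigzag]) is a linear
    forest. If [#|A| < #|~: A|], let it start and end in [~: A] and visit all
    of [A]: it has [2 * #|A|] edges, and it is covered by [S := A], since every
    edge of the graph meets [A] and every vertex of [A] is interior to the
    path. If the sides have equal size, let it visit all the vertices: it has
    [2 * #|A| - 1] edges, and it is covered by [S := set0], since the
    whole graph is then a single component of the path. *)

Set Implicit Arguments.
Unset Strict Implicit.
Unset Printing Implicit Defensive.

(** * Edges and components of subgraphs *)

Section Subgraphs.
Variable G : sgraph.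
Implicit Types (F : subgraph G) (A : {set G}).

Lemma sadj_sym F : symmetric (sadj F).
Proof. by move=> x y; rewrite /sadj setUC. Qed.

Lemma sadj_sverts F x y : sadj F x y -> (x \in sverts F) && (y \in sverts F).
Proof. by move/sedges_sverts/subsetP=> sub; rewrite !sub // !inE eqxx ?orbT. Qed.

Lemma sedgesP F e :
  e \in sedges F -> exists x y, [/\ adj x y, sadj F x y & e = [set x; y]].
Proof.
move=> eF; have := subsetP (sedges_edges F) _ eF.
rewrite inE => /existsP[x /existsP[y /andP[xy /eqP e_def]]].
by exists x, y; rewrite /sadj -e_def.
Qed.

Lemma set2_inj (x y z t : G) :
  [set x; y] = [set z; t] -> x = z /\ y = t \/ x = t /\ y = z.
Proof.
move/setP=> E; have := E x; have := E y; have := E z; have := E t.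
rewrite !inE !eqxx ?orbT /=.
move=> Et Ez /esym Ey /esym /orP[] /eqP xE; subst x; [left | right]; split=> //.
  by case/orP: Ey Et => /eqP-> //; rewrite orbb => /eqP.
by case/orP: Ey Ez => /eqP-> //; rewrite orbb => /eqP.
Qed.

Lemma sadj_adj F x y : sadj F x y -> adj x y.
Proof.
case/sedgesP=> z [t [zt _ /set2_inj[[-> ->]|[-> ->]]]] //.
by rewrite adj_sym.
Qed.

Lemma mem_components F x : x \in sverts F ->
  [set y in sverts F | connect (sadj F) x y] \in components F.
Proof. by move=> xF; apply/imsetP; exists x. Qed.

(** * Upper bounds on the number of edges of a linear forest *)

(** In the path [s] of its component, a vertex can only be adjacent to its
    predecessor and its successor. *)
Lemma linear_forest_sdeg F x : linear_forest F -> sdeg F x <= 2.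
Proof.
move=> linF; have [xF|xNF] := boolP (x \in sverts F); last first.
  rewrite /sdeg eq_card0 // => y; rewrite inE.
  by apply: contraNF xNF => /sadj_sverts/andP[].
have [s [_ _ Cs sE]] := linF _ (mem_components xF).
apply: leq_trans (_ : #|[set nth x s (index x s).+1; nth x s (index x s).-1]|
                        <= 2); last by rewrite cards2; case: (_ == _).
apply/subset_leq_card/subsetP=> y; rewrite inE => xy.
have /andP[_ yF] := sadj_sverts xy.
have xC : x \in [set y in sverts F | connect (sadj F) x y].
  by rewrite inE xF connect0.
have yC : y \in [set y in sverts F | connect (sadj F) x y].
  by rewrite inE yF connect1.
have ys : y \in s by rewrite -Cs.
move: xy; rewrite sE // => /orP[] /eqP E; rewrite !inE.
  by rewrite -E nth_index // eqxx.
by rewrite E /= nth_index // eqxx orbT.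
Qed.

(** The first vertex of the path of any component has no predecessor. In a
    forest without vertices, every vertex of [G] has degree 0. *)
Lemma linear_forest_low_degree F (x : G) :
  linear_forest F -> exists v, sdeg F v <= 1.
Proof.
move=> linF; have [F0|[z zF]] := set_0Vmem (sverts F).
  exists x; rewrite /sdeg eq_card0 // => y; rewrite inE.
  by apply/negP=> /sadj_sverts; rewrite F0 inE.
have [[|v s] [] // _ _ Cs sE] := linF _ (mem_components zF).
exists v.
apply: leq_trans (_ : #|[set nth v (v :: s) 1]| <= 1); last by rewrite cards1.
apply/subset_leq_card/subsetP=> y; rewrite inE => vy.
have vC : v \in [set y in sverts F | connect (sadj F) z y].
  by rewrite Cs mem_head.
have yC : y \in [set y in sverts F | connect (sadj F) z y].
  have /andP[_ yF] := sadj_sverts vy.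
  move: vC; rewrite !inE yF => /andP[_ zv].
  exact: connect_trans zv (connect1 vy).
have ys : y \in v :: s by rewrite -Cs.
move: vy; rewrite sE // [index v _]/= eqxx => /orP[] // /eqP E.
by rewrite inE -E nth_index.
Qed.

Definition vertex_cover A := forall x y : G, adj x y -> (x \in A) || (y \in A).

(** Each edge of [F] belongs to the star in [F] of some vertex of the cover. *)
Lemma card_sedges_cover F A :
  vertex_cover A -> #|sedges F| <= \sum_(x in A) sdeg F x.
Proof.
move=> covA.
pose star x := [set [set x; y] | y in [set y | sadj F x y]].
apply: (@leq_trans #|\bigcup_(x in A) star x|).
  apply/subset_leq_card/subsetP=> e /sedgesP[x [y [xy Fxy ->]]].
  case/orP: (covA _ _ xy) => zA; apply/bigcupP.
    by exists x => //; apply/imsetP; exists y; rewrite ?inE.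
  exists y => //; apply/imsetP; exists x; last by rewrite setUC.
  by rewrite inE sadj_sym.
apply: (big_ind2 (fun (U : {set {set G}}) n => #|U| <= n)).
- by rewrite cards0.
- move=> U m V n Um Vn; apply: leq_trans (leq_add Um Vn).
  by rewrite cardsU leq_subr.
- by move=> x _; apply: leq_imset_card.
Qed.

Lemma linear_forest_leq_cover F A :
  linear_forest F -> vertex_cover A -> #|sedges F| <= #|A|.*2.
Proof.
move=> linF /(card_sedges_cover F)/leq_trans; apply.
rewrite -muln2 -sum_nat_const.
by apply: leq_sum => x _; apply: linear_forest_sdeg.
Qed.

Lemma linear_forest_ltn_cover F A v :
    linear_forest F -> vertex_cover A -> v \in A -> sdeg F v <= 1 ->
  #|sedges F| < #|A|.*2.
Proof.
move=> linF /(card_sedges_cover F) le_sum vA v1; apply: leq_ltn_trans le_sum _.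
rewrite -muln2 -sum_nat_const !(bigD1 v vA) /=.
rewrite -addSn; apply: leq_add => //.
by apply: leq_sum => x _; apply: linear_forest_sdeg.
Qed.

End Subgraphs.

(** * The subgraph traced by a path *)

Section PathSubgraph.
Variables (G : sgraph) (s : seq G).
Hypotheses (s_uniq : uniq s) (s_path : sorted (@adj G) s).

Definition consecutive (x y : G) : bool :=
  [&& x \in s, y \in s & index y s == (index x s).+1].

(** Keeping only edges of [G] makes this a subgraph for every sequence [s]; no
    consecutive pair is lost when [s] is a path of [G]. *)
Definition path_edges : {set {set G}} :=
  [set e in edges G |
     [exists x, exists y, consecutive x y && (e == [set x; y])]].

Lemma path_edges_edges : path_edges \subset edges G.
Proof. by apply/subsetP=> e; rewrite inE => /andP[]. Qed.

Lemma path_edges_sverts e : e \in path_edges -> e \subset [set x in s].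
Proof.
rewrite inE => /andP[_ /existsP[x /existsP[y /andP[/and3P[xs ys _] /eqP->]]]].
by apply/subsetP=> z; rewrite !inE => /orP[] /eqP->.
Qed.

Definition path_subgraph : subgraph G :=
  Subgraph path_edges_edges path_edges_sverts.

Lemma consecutive_adj x y : consecutive x y -> adj x y.
Proof.
case/and3P=> xs ys /eqP xy.
rewrite -(nth_index x xs) -[y in adj _ y](nth_index x ys) xy.
by apply: (sortedP x s_path); rewrite -xy index_mem.
Qed.

Lemma path_sadj x y :
  sadj path_subgraph x y = consecutive x y || consecutive y x.
Proof.
rewrite /sadj inE; apply/andP/orP=> [[_]|].
  case/existsP=> z /existsP[t /andP[zt /eqP/set2_inj[][-> ->]]]; first by left.
  by right.
have mem_edges z t : consecutive z t -> [set z; t] \in path_edges.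
  move=> zt; rewrite !inE.
  apply/andP; split; apply/existsP; exists z; apply/existsP; exists t.
    by rewrite consecutive_adj // eqxx.
  by rewrite zt eqxx.
case=> /mem_edges; first by rewrite inE => /andP.
by rewrite setUC inE => /andP.
Qed.

Lemma consecutive_nth x0 i :
  i.+1 < size s -> consecutive (nth x0 s i) (nth x0 s i.+1).
Proof.
move=> lt_is; have lt_i := ltnW lt_is.
by rewrite /consecutive !mem_nth // !index_uniq ?eqxx.
Qed.

Lemma path_connect : {in s &, forall x y, connect (sadj path_subgraph) x y}.
Proof.
move=> x y xs ys.
have from_head i : i < size s ->
    connect (sadj path_subgraph) (nth x s 0) (nth x s i).
  elim: i => [|i IH] lt_is; first exact: connect0.
  apply: connect_trans (IH (ltnW lt_is)) (connect1 _).
  by rewrite path_sadj consecutive_nth.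
have /sym_connect_sym cs := sadj_sym path_subgraph.
apply: (@connect_trans _ _ (nth x s 0)).
  by rewrite cs -{2}(nth_index x xs) from_head ?index_mem.
by rewrite -(nth_index x ys) from_head ?index_mem.
Qed.

Lemma path_linear_forest : linear_forest path_subgraph.
Proof.
move=> C /imsetP[x]; rewrite inE => xs ->.
have CE : [set y in sverts path_subgraph | connect (sadj path_subgraph) x y]
          =i s.
  move=> y; rewrite !inE; apply/andb_idr=> ys; exact: path_connect.
exists s; split=> // [|y z]; first by case: (s) xs.
by rewrite !CE => ys zs; rewrite path_sadj /consecutive ys zs.
Qed.

(** As [s] has no repetition, the edges between ranks [i] and [i.+1] are
    pairwise distinct. *)
Lemma card_path_edges : (size s).-1 <= #|sedges path_subgraph|.
Proof.
case: (posnP (size s)) => [-> //|]; rewrite -has_predT => /hasP[x0 _ _].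
pose edge (i : 'I_(size s).-1) := [set nth x0 s i; nth x0 s i.+1].
have lt_s (i : 'I_(size s).-1) : i.+1 < size s by rewrite -ltn_predRL.
have edge_inj : injective edge.
  move=> i j /set2_inj; have [si sj] := (ltnW (lt_s i), ltnW (lt_s j)).
  case=> -[/eqP E1 /eqP E2].
    by apply/val_inj/eqP; rewrite -(nth_uniq x0 si sj s_uniq).
  (* The crossed case would give both [i = j.+1] and [i.+1 = j]. *)
  rewrite !nth_uniq ?lt_s // in E1 E2.
  by have := ltnn i; rewrite {2}(eqP E1) -(eqP E2) leqnSn.
rewrite -[leqLHS]card_ord -cardsT -(card_imset _ edge_inj).
apply/subset_leq_card/subsetP=> _ /imsetP[i _ ->].
have := path_sadj (nth x0 s i) (nth x0 s i.+1).
by rewrite consecutive_nth ?lt_s.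
Qed.

Lemma path_sdeg_interior x0 i :
  i.+2 < size s -> 1 < sdeg path_subgraph (nth x0 s i.+1).
Proof.
move=> lt_is; have lt_i1 := ltnW lt_is; have lt_i := ltnW lt_i1.
rewrite (@leq_trans #|[set nth x0 s i; nth x0 s i.+2]|) //.
  by rewrite cards2 nth_uniq // neq_ltn leqnSn.
apply/subset_leq_card/subsetP=> y; rewrite !inE path_sadj.
by case/orP=> /eqP->; rewrite consecutive_nth ?orbT.
Qed.

End PathSubgraph.

(** * Zigzag paths between the sides of a complete bipartite graph *)

Section Bipartition.
Variable G : sgraph.
Implicit Type A : {set G}.

Definition complete_bipartition A :=
  forall x y : G, adj x y = ((x \in A) != (y \in A)).

Lemma complete_bipartitionC A :
  complete_bipartition A -> complete_bipartition (~: A).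
Proof. by move=> bipA x y; rewrite bipA !inE; do 2!case: (_ \in A). Qed.

Lemma bipartition_cover A : complete_bipartition A -> vertex_cover A.
Proof. by move=> bipA x y; rewrite bipA; do 2!case: (_ \in A). Qed.

(** The sides are listed by [enum]; the vertices of odd rank run through [A],
    those of even rank through its complement. *)
Definition zigzag_nth (x0 : G) A i : G :=
  nth x0 (enum (if odd i then A else ~: A)) i./2.

Definition zigzag (x0 : G) A n : seq G := mkseq (zigzag_nth x0 A) n.

Section Zigzag.
Variables (x0 : G) (A : {set G}) (n : nat).
Hypotheses (bipA : complete_bipartition A).
Hypotheses (nA : n./2 <= #|A|) (nAc : uphalf n <= #|~: A|).

Lemma zigzag_half i :
  i < n -> i./2 < size (enum (if odd i then A else ~: A)).
Proof.
move=> lt_in; rewrite -cardE; case: ifP => odd_i.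
  apply: leq_trans nA; apply: leq_trans (half_leq lt_in).
  by rewrite /= uphalf_half odd_i.
by apply: leq_trans nAc; apply: leq_trans (uphalf_leq lt_in).
Qed.

Lemma zigzag_nth_side i : i < n -> (zigzag_nth x0 A i \in A) = odd i.
Proof.
move/zigzag_half/(mem_nth x0); rewrite mem_enum -/(zigzag_nth x0 A i).
by case: (odd i) => //; rewrite inE => /negPf.
Qed.

(** Equal vertices lie on the same side, hence have ranks of the same parity,
    and the list of each side has no repetition. *)
Lemma zigzag_nth_inj i j :
  i < n -> j < n -> zigzag_nth x0 A i = zigzag_nth x0 A j -> i = j.
Proof.
move=> lt_in lt_jn E.
have odd_ij : odd i = odd j by rewrite -!zigzag_nth_side // E.
have ltj := zigzag_half lt_jn; have lti := zigzag_half lt_in.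
move/eqP: E; rewrite /zigzag_nth odd_ij in lti *.
rewrite nth_uniq ?enum_uniq // => /eqP half_ij.
by rewrite -(odd_double_half i) odd_ij half_ij odd_double_half.
Qed.

Lemma zigzag_uniq : uniq (zigzag x0 A n).
Proof.
apply/(mkseq_uniqP (zigzag_nth x0 A)) => i j; rewrite !inE.
exact: zigzag_nth_inj.
Qed.

Lemma zigzag_sorted : sorted (@adj G) (zigzag x0 A n).
Proof.
apply/(sortedP x0) => i; rewrite size_mkseq => lt_in.
have lt_i := ltnW lt_in.
by rewrite !nth_mkseq // bipA !zigzag_nth_side //=; case: (odd i).
Qed.

End Zigzag.

(** With [2 * #|A| + 1] vertices, the zigzag exhausts [A] and has both ends in
    [~: A]. So it attains the bound of [linear_forest_leq_cover], and the
    vertices of [A], all of degree 2 in it, can be taken as [S]. *)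
Lemma unbalanced_LF_coverable A :
  complete_bipartition A -> #|A| < #|~: A| -> LF_coverable G.
Proof.
move=> bipA ltA.
have [x0 _] : exists x, x \in ~: A by apply/card_gt0P/(leq_ltn_trans _ ltA).
pose n := #|A|.*2.+1; pose s := zigzag x0 A n.
have nA : n./2 <= #|A| by rewrite /= uphalf_double.
have nAc : uphalf n <= #|~: A| by rewrite /= doubleK.
have s_uniq : uniq s := zigzag_uniq x0 nA nAc.
have s_path : sorted (@adj G) s := zigzag_sorted x0 bipA nA nAc.
have mem_s x : x \in A ->
    exists2 i, i.+2 < size s & x = nth x0 s i.+1.
  move=> xA; have lt_is : (index x (enum A)).*2.+2 < size s.
    by rewrite size_mkseq ltnS -doubleS leq_double cardE index_mem mem_enum.
  exists (index x (enum A)).*2 => //.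
  rewrite nth_mkseq; last by move: lt_is; rewrite size_mkseq => /ltnW.
  by rewrite /zigzag_nth /= odd_double uphalf_double nth_index ?mem_enum.
exists (path_subgraph s), A; split.
- split=> [|F linF]; first exact: path_linear_forest.
  apply: leq_trans (card_path_edges s_uniq s_path); rewrite size_mkseq.
  exact/linear_forest_leq_cover/bipartition_cover.
- by apply/subsetP=> x /mem_s[i lt_is ->]; rewrite inE mem_nth // ltnW.
- move=> x /mem_s[i lt_is ->].
  by rewrite negb_and -ltnNge path_sdeg_interior ?orbT.
- move=> x y xA yA; apply/negP=> /sadj_adj.
  by rewrite bipA xA yA.
by move=> x y /(bipartition_cover bipA)/orP; left.
Qed.

(** The zigzag through all vertices is connected, so nothing has to be removed
    to cover the edges of [G]. It attains the bound of
    [linear_forest_ltn_cover], applied to the side that contains a vertex of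
    degree at most 1 of the other linear forest. *)
Lemma balanced_LF_coverable A :
  complete_bipartition A -> 0 < #|A| -> #|A| = #|~: A| -> LF_coverable G.
Proof.
move=> bipA /card_gt0P[x0 x0A] eqA.
pose n := #|A|.*2; pose s := zigzag x0 A n.
have nA : n./2 <= #|A| by rewrite doubleK.
have nAc : uphalf n <= #|~: A| by rewrite uphalf_double eqA.
have s_uniq : uniq s := zigzag_uniq x0 nA nAc.
have s_path : sorted (@adj G) s := zigzag_sorted x0 bipA nA nAc.
have mem_s x : x \in s.
  have sT : s =i G.
    apply/(subset_cardP _)/subsetP => //.
    by rewrite (card_uniqP s_uniq) size_mkseq -(cardsC A) -eqA addnn.
  by rewrite sT.
exists (path_subgraph s), set0; split.
- split=> [|F linF]; first exact: path_linear_forest.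
  apply: leq_trans (card_path_edges s_uniq s_path); rewrite size_mkseq.
  have [v v1] := linear_forest_low_degree x0 linF.
  rewrite -ltnS; apply: leq_trans (leqSpred _).
  have [vA|vNA] := boolP (v \in A).
    exact: linear_forest_ltn_cover linF (bipartition_cover bipA) vA v1.
  rewrite /n eqA; apply: linear_forest_ltn_cover linF _ _ v1.
    exact/bipartition_cover/complete_bipartitionC.
  by rewrite inE.
- exact: sub0set.
- by move=> x; rewrite inE.
- by move=> x y; rewrite inE.
move=> x y _; right.
exists [set z in sverts (del_verts (path_subgraph s) set0)
         | connect (sadj (del_verts (path_subgraph s) set0)) x z].
  by apply: mem_components; rewrite !inE mem_s.
have del0 : sadj (del_verts (path_subgraph s) set0) =2 sadj (path_subgraph s).
  by move=> z t; rewrite /sadj inE -setI_eq0 setI0 eqxx andbT.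
by rewrite !inE !mem_s connect0 (eq_connect del0) path_connect.
Qed.

End Bipartition.

Theorem proposition2p21 (a b : nat) (ha : 1 <= a) (hb : 1 <= b) :
  LF_coverable (complete_bipartite a b).
Proof.
pose A : {set complete_bipartite a b} := [set inl i | i : 'I_a].
have mem_inl i : (inl i : complete_bipartite a b) \in A by apply: imset_f.
have mem_inr j : (inr j : complete_bipartite a b) \in A = false.
  by apply/negP=> /imsetP[].
have bipA : complete_bipartition A.
  by move=> [x|x] [y|y]; rewrite ?mem_inl ?mem_inr.
have cardA : #|A| = a by rewrite card_imset ?card_ord // => i j [].
have cardAc : #|~: A| = b.
  by rewrite cardsCs setCK cardA card_sum !card_ord addKn.
case: (ltngtP a b) => [lt_ab|lt_ba|eq_ab].
- by apply: (unbalanced_LF_coverable bipA); rewrite cardA cardAc.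
- apply: (unbalanced_LF_coverable (complete_bipartitionC bipA)).
  by rewrite setCK cardA cardAc.
by apply: (balanced_LF_coverable bipA); rewrite ?cardAc cardA.
Qed.
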